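(* Let $A$ be a closed symmetric operator in a Hilbert space $\mathfrak H$ with defect numbers $n_\pm(A)$, let $\mathcal H$ be a Hilbert space, and let $\Gamma:\mathfrak H^2\to\mathcal H^2$ be a boundary relation for $A^*$ (so that $\ker\Gamma=A$). Then: (i) $n_\pm(A)\le\dim\mathcal H$; (ii) if $n_\pm(A)<\infty$, then $\dim\mathcal H-n_\pm(A)=\dim\operatorname{mul}\Gamma$; (iii) if $\dim\mathcal H<\infty$, then $n_+(A)=n_-(A)$.
   Context: A linear relation $\Gamma:\mathfrak H^2\to\mathcal H^2$ is a linear subspace of $\mathfrak H^2\times\mathcal H^2$, $\mathfrak H^2=\mathfrak H\oplus\mathfrak H$; $\operatorname{mul}\Gamma=\{\widehat h:\{0,\widehat h\}\in\Gamma\}$, $\ker\Gamma=\{\widehat f:\{\widehat f,0\}\in\Gamma\}$. Write $\widehat f=\{f,f'\}$, etc. The adjoint $A^*$ of a (not necessarily densely defined) operator is a linear relation: $A^*=\{\{h,k\}:(k,f)=(h,g)\text{ for all }\{f,g\}\in A\}$. Defect numbers: $n_\pm(A)=\dim\ker(A^*-\lambda)$ for $\lambda\in\mathbb C_\pm$ (up to the usual convention of which half-plane corresponds to which sign). Boundary relation: for a closed symmetric linear relation $S$ in $\mathfrak H$, a linear relation $\Gamma:\mathfrak H^2\to\mathcal H^2$ is a boundary relation for $S^*$ if (G1) $\operatorname{dom}\Gamma$ is dense in $S^*$ and $(f',g)_{\mathfrak H}-(f,g')_{\mathfrak H}=(h',k)_{\mathcal H}-(h,k')_{\mathcal H}$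 for all $\{\widehat f,\widehat h\},\{\widehat g,\widehat k\}\in\Gamma$; (G2) if $\{\widehat g,\widehat k\}\in\mathfrak H^2\times\mathcal H^2$ satisfies this identity for every $\{\widehat f,\widehat h\}\in\Gamma$, then $\{\widehat g,\widehat k\}\in\Gamma$. Then $\ker\Gamma=S$. *)

(* Defs.v *)
From HB Require Import structures.
From mathcomp Require Import all_boot all_order all_algebra.
From mathcomp Require Import complex.
From mathcomp Require Import all_classical all_reals all_analysis.

Set Implicit Arguments.
Unset Strict Implicit.
Unset Printing Implicit Defensive.
Import Order.TTheory GRing.Theory Num.Theory.
Import numFieldNormedType.Exports.

Local Open Scope classical_set_scope.
Local Open Scope ring_scope.
Local Open Scope complex_scope.

(* [inner] is linear in its first and conjugate-linear in its second argument. *)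
HB.mixin Record CompleteNormedModule_isHilbert (R : realType) H
    of CompleteNormedModule R[i] H := {
  inner : {dot H for Num.conj};
  inner_normE : forall x : H, inner x x = `|x| ^+ 2 }.

#[short(type="hilbertType")]
HB.structure Definition Hilbert (R : realType) :=
  {H of CompleteNormedModule_isHilbert R H & CompleteNormedModule R[i] H}.

Definition inner2 (R : realType) (H : hilbertType R) (x y : H * H) : R[i] :=
  inner x.1 y.1 + inner x.2 y.2.

Section HilbertDimension.
Variables (R : realType) (U : choiceType) (ip : U -> U -> R[i]).

Definition orthonormal_set (E : set U) :=
  forall e f, E e -> E f -> ip e f = (e == f)%:R.

Definition orthonormal_basis (V E : set U) :=
  [/\ E `<=` V, orthonormal_set E &
    forall F, E `<=` F -> F `<=` V -> orthonormal_set F -> F = E].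

Lemma orthonormal_basis_exists V : exists E, orthonormal_basis V E.
Proof.
pose P := [set E | E `<=` V /\ orthonormal_set E].
have [|E [[EV Eo] Emax]] := @Zorn_bigcup U P.
  move=> F FP Ftot; split=> [x [E /FP[EV _]]|e f [E FE Ee] [E' FE' E'f]].
    exact: EV.
  case: (Ftot _ _ FE FE') => EE'.
    by have [_] := FP _ FE'; apply=> //; exact: EE'.
  by have [_] := FP _ FE; apply=> //; exact: EE'.
exists E; split=> // F EF FV Fo; apply: contrapT => FE.
apply: (Emax F); last by split.
by rewrite properEneq; split=> //; apply/eqP => /esym.
Qed.

(* The Hilbert dimension of V is the cardinal of an orthonormal basis; since
   cardinals are handled through the relations [#<=] and [#=] on sets, it is
   represented by a basis itself. For a closed subspace of a Hilbert space,
   maximal orthonormal subsets exactly are the orthonormal ones with dense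
   span, and they all have the same cardinal. *)
Definition hdim (V : set U) : set U := sval (cid (orthonormal_basis_exists V)).

Lemma hdimP V : orthonormal_basis V (hdim V).
Proof. by rewrite /hdim; case: cid. Qed.

End HilbertDimension.

(* The disjoint union, representing the sum of two cardinals. *)
Definition set_sum T U (A : set T) (B : set U) : set (T + U) :=
  [set x | match x with inl a => A a | inr b => B b end].

Section LinearRelations.
Variables (K : pzRingType) (U V : lmodType K).
Implicit Type G : set (U * V).

Definition linear_relation G :=
  G 0 /\ forall (a : K) p q, G p -> G q -> G (a *: p + q).

Definition rdom G : set U := [set u | exists v, G (u, v)].
Definition rker G : set U := [set u | G (u, 0)].
Definition rmul G : set V := [set v | G (0, v)].

End LinearRelations.

(* The relation T - lam. *)
Definition rshift (K : pzRingType) (U : lmodType K) (T : set (U * U)) (lam : K) :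
  set (U * U) := [set (p.1, p.2 - lam *: p.1) | p in T].

Section SymmetricRelations.
Variables (R : realType) (H : hilbertType R).
Implicit Types (S A : set (H * H)) (lam : R[i]).

Definition radjoint S : set (H * H) :=
  [set p | forall q, S q -> inner p.2 q.1 = inner p.1 q.2].

Definition closed_symmetric_relation S :=
  [/\ linear_relation S, closed S & S `<=` radjoint S].

(* Operators are identified with their graphs. *)
Definition closed_symmetric_operator A :=
  closed_symmetric_relation A /\ rmul A = [set 0].

Definition defect_number A lam : set H :=
  hdim (@inner R H) (rker (rshift (radjoint A) lam)).

End SymmetricRelations.

Section BoundaryRelations.
Variables (R : realType) (H K : hilbertType R).

Definition green_identity (p q : (H * H) * (K * K)) :=
  inner p.1.2 q.1.1 - inner p.1.1 q.1.2 =
  inner p.2.2 q.2.1 - inner p.2.1 q.2.2.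

(* G is a boundary relation for the adjoint of S. *)
Definition boundary_relation (S : set (H * H)) (G : set ((H * H) * (K * K))) :=
  [/\ linear_relation G,
      rdom G `<=` radjoint S /\ radjoint S `<=` closure (rdom G),
      forall p q, G p -> G q -> green_identity p q
    & forall q, (forall p, G p -> green_identity p q) -> G q].

End BoundaryRelations.

(* Main.v *)
Require Import Defs.
From HB Require Import structures.
From mathcomp Require Import all_boot all_order all_algebra.
From mathcomp Require Import complex finmap ring.
From mathcomp Require Import all_classical all_reals all_analysis.
Import Order.TTheory GRing.Theory Num.Theory.
Import numFieldNormedType.Exports.
Local Open Scope classical_set_scope.
Local Open Scope card_scope.
Local Open Scope ring_scope.
Local Open Scope complex_scope.
Set Implicit Arguments.
Unset Strict Implicit.
Unset Printing Implicit Defensive.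

(** Why the theorem holds.  Put [p = ((f, h), (f', - h'))] for
    [((f, f'), (h, h'))] in [G].  Green's identity says that these pairs form a
    symmetric relation in the Hilbert sum of H and K, and maximality says that
    it is selfadjoint.  Hence for every nonreal [lam] the relation minus [lam]
    is onto ([surjective_shift]), and its inverse, the resolvent [S], satisfies
    [S(lam)^* = S(conj lam)] ([resolvent_adjoint]).

    Let N be the defect space of A at [lam] and let
    [V e = P_H (S(lam) (0, e))], a map from K to N.  Its adjoint maps [y] to
    [k = P_K (S(conj lam) (y, 0))] and is injective on N
    ([defect_resolvent_eq0]): if [k = 0], then [y] is in the range of
    [ker G - conj lam], and N is orthogonal to that range because [dom G] is
    dense in the adjoint of A.  So V has dense range in N.  Its kernel is the
    bijective image of [mul G] under [(h, h') |-> - h' - lam h].  Splitting K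
    into the kernel of V and its orthogonal complement gives
    [dim K = dim N + dim (mul G)] for every nonreal [lam].  The three claims
    follow: the first two directly, the third by cancelling the finite
    cardinal of [mul G].

    Dimensions are cardinals of orthonormal bases, and all comparisons go
    through one principle, [card_orthonormal_le_total]: an orthonormal set in a
    space V has at most as many elements as a family [v] that is orthogonal to
    no nonzero vector of V.  Both inequalities in the dimension formula
    ([card_defect_sum_le], [card_le_defect_sum]) amount to writing down such a
    family with the help of the resolvents, and the splitting of K need not be
    carried out.  The principle itself is linear algebra when the family is
    finite; when it is infinite, Bessel's inequality shows that each [v i] is
    orthogonal to all but countably many elements of the orthonormal set, and
    [I * nat] has the cardinal of [I] ([card_setX_nat]). *)

(** * Cardinals *)

(** An injection may be given by a relation; the choice of values, and the case of
    an empty codomain, are dealt with once here. *)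
Lemma card_le_functional T U (A : set T) (B : set U) (r : T -> U -> Prop) :
  (forall x, A x -> exists2 y, B y & r x y) ->
  (forall x x' y, A x -> A x' -> r x y -> r x' y -> x = x') ->
  A #<= B.
Proof.
elim/Ppointed: U B r => U B r rB rinj.
  suff -> : A = set0 by exact: card_ge0.
  by apply/eqP/negPn/negP => /set0P[x /rB[y]]; case: (no y).
have {rB}/choice[f fP] x : exists y, A x -> B y /\ r x y.
  have [Ax|nAx] := pselect (A x); last by exists point.
  by have [y] := rB _ Ax; exists y.
apply/pcard_leP/injfunPex; exists f => [x Ax|x x'].
  by have [] := fP _ Ax.
rewrite !inE => Ax Ax' e; apply: (rinj _ _ (f x)) => //.
  by have [] := fP _ Ax.
by rewrite e; have [] := fP _ Ax'.
Qed.

Lemma card_le_injection T U (A : set T) (B : set U) :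
  A #<= B -> A !=set0 ->
  exists2 f : T -> U, forall x, A x -> B (f x) &
    forall x y, A x -> A y -> f x = f y -> x = y.
Proof.
move=> + [x0 Ax0]; elim/Ppointed: U B => U B.
  by rewrite card_le_emptyr => /eqP A0; rewrite A0 in Ax0.
move=> /pcard_leP/injfunPex[f fB finj]; exists f => // x y Ax Ay.
by apply: finj; rewrite inE.
Qed.

Section DisjointSequences.
Variables (T : Type) (A : set T).

(** A family of injective sequences in [A] with pairwise disjoint ranges; the case
    [f = g] of the second clause is injectivity. *)
Definition disjoint_sequences (F : set (nat -> T)) :=
  (forall f n, F f -> A (f n)) /\
  (forall f g m n, F f -> F g -> f m = g n -> f = g /\ m = n).

(** Take a maximal family: if infinitely many points were left over, one more
    sequence would fit among them. *)
Lemma exhausting_disjoint_sequences :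
  exists2 F, disjoint_sequences F &
    finite_set (A `\` [set x | exists2 f, F f & range f x]).
Proof.
have [|F [[FA Finj] Fmax]] := @Zorn_bigcup (nat -> T) disjoint_sequences.
  move=> C CP Ctot; split=> [f n [F CF Ff]|f g m n [F CF Ff] [F' CF' F'g]].
    by have [FA _] := CP _ CF; exact: FA.
  have [FF'|F'F] := Ctot _ _ CF CF'.
    by have [_] := CP _ CF'; apply=> //; exact: FF'.
  by have [_] := CP _ CF; apply=> //; exact: F'F.
exists F => //; apply: contrapT => /infiniteP.
move=> /card_le_injection[|h hB hinj]; first by exists 0%N.
have hF f m n : F f -> f m <> h n.
  by move=> Ff e; have [_] := hB n I; apply; exists f => //; exists m.
apply: (Fmax (F `|` [set h])); last split.
- rewrite properEneq; split=> [|f Ff]; last by left.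
  apply/eqP => e; have Fh : F h by rewrite e; right.
  exact: (hF h 0%N 0%N).
- by move=> f n [/FA|->]//; have [] := hB n I.
- move=> f g m n [Ff|->] [Fg|->] e.
  + exact: Finj.
  + by case: (hF _ _ _ Ff e).
  + by case: (hF _ _ _ Fg (esym e)).
  + by split=> //; exact: hinj.
Qed.

(** Up to a finite remainder, [A] is [F * nat] for a family [F] of disjoint
    sequences, and [nat * nat] is countable.  The remainder is placed inside one
    of the sequences by moving the sequences to the even indices. *)
Lemma card_setX_nat : infinite_set A -> A `*` [set: nat] #<= A.
Proof.
move=> Aoo; have [F [FA Finj]] := exhausting_disjoint_sequences.
set B := _ `\` _ => Bfin.
have [f0 Ff0] : F !=set0.
  apply/set0P/negP => /eqP F0; apply: Aoo; apply: sub_finite_set Bfin => x Ax.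
  by split=> // -[f]; rewrite F0.
have [idx idxinj] : exists idx : T -> nat, {in B &, injective idx}.
  by apply/countable_injP; exact: finite_set_countable.
(* Even indices code the points on the sequences, odd ones the remainder. *)
pose code x (c : (nat -> T) * nat) := F c.1 /\
  ((exists2 m, x = c.1 m & c.2 = m.*2) \/ (B x /\ c.2 = (idx x).*2.+1)).
have codeP x : A x -> exists c, code x c.
  move=> Ax; have [Bx|nBx] := pselect (B x).
    by exists (f0, (idx x).*2.+1); split=> //; right.
  have [f Ff [m _ fm]] : exists2 f, F f & range f x.
    by apply: contrapT => nF; apply: nBx.
  by exists (f, m.*2); split=> //; left; exists m.
have codeinj x y c : code x c -> code y c -> x = y.
  move=> [_ [[m -> cm]|[Bx cx]]] [_ [[n -> cn]|[By cy]]].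
  - by congr (c.1 _); apply: double_inj; rewrite -cm -cn.
  - by have := congr1 odd cm; rewrite cy /= !odd_double.
  - by have := congr1 odd cn; rewrite cx /= !odd_double.
  - by apply: idxinj; rewrite ?inE//; apply: double_inj; apply: succn_inj; rewrite -cx -cy.
apply: (@card_le_functional _ _ _ _ (fun p y =>
   exists2 c, code p.1 c & y = c.1 (choice.pickle (c.2, p.2)))).
  move=> [x n] [/= /codeP[c cx] _]; exists (c.1 (choice.pickle (c.2, n))); last by exists c.
  by apply: FA; case: cx.
move=> [x n] [x' n'] y _ _ [[f k] /= cx ->] [[f' k'] /= cx' e].
have [ff' /(pcan_inj choice.pickleK)[kk' nn']] := Finj _ _ _ _ cx.1 cx'.1 e.
by rewrite /= in ff'; rewrite -ff' -kk' in cx'; rewrite (codeinj _ _ _ cx cx') nn'.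
Qed.

End DisjointSequences.

Lemma card_le_countable_fibers T U (E : set T) (I : set U) (r : T -> U -> Prop) :
  infinite_set I ->
  (forall x, E x -> exists2 i, I i & r x i) ->
  (forall i, I i -> countable [set x | E x /\ r x i]) ->
  E #<= I.
Proof.
move=> Ioo rI rc; apply: card_le_trans (card_setX_nat Ioo).
have {rc}/choice[c cinj] i : exists c : T -> nat, I i -> {in [set x | E x /\ r x i] &, injective c}.
  have [Ii|nIi] := pselect (I i); last by exists (fun=> 0%N).
  by have /countable_injP[c cP] := rc _ Ii; exists c.
apply: (@card_le_functional _ _ _ _ (fun x p => [/\ I p.1, r x p.1 & p.2 = c p.1 x])).
  by move=> x /rI[i Ii rxi]; exists (i, c i x).
move=> x x' [i n] Ex Ex' [/= Ii rx ->] [_ rx' e].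
by apply: (cinj i); rewrite ?inE.
Qed.

Lemma card_set_sum_fset (T U : choiceType) (A : set T) (B : set U) :
  finite_set A -> finite_set B ->
  finite_set (set_sum A B) /\
  #|` fset_set (set_sum A B)|%N = (#|` fset_set A| + #|` fset_set B|)%N.
Proof.
move=> Afin Bfin.
have AB : set_sum A B = (inl @` A) `|` (inr @` B).
  apply/seteqP; split=> [[x|y] xy|_ [[x Ax <-]|[y By <-]]] //=.
    by left; exists x.
  by right; exists y.
rewrite AB; split; first by rewrite finite_setU; split; exact: finite_image.
rewrite fset_setU ?fset_set_image//; try exact: finite_image.
rewrite cardfsU (_ : fsetI _ _ = fset0); last first.
  apply/fsetP => z; rewrite !inE; apply/negbTE/negP => /andP[].
  by move=> /imfsetP[x /= _ ->] /imfsetP[y /= _].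
by rewrite cardfs0 subn0 !card_imfset// => ? ? [].
Qed.

Lemma card_set_sum_cancel (T T' U : choiceType) (A : set T) (A' : set T') (B : set U) :
  finite_set A -> finite_set A' -> finite_set B ->
  set_sum A B #= set_sum A' B -> A #= A'.
Proof.
move=> Afin A'fin Bfin.
have [ABfin ABE] := card_set_sum_fset Afin Bfin.
have [A'Bfin A'BE] := card_set_sum_fset A'fin Bfin.
move=> /(fcard_eq ABfin A'Bfin); rewrite ABE A'BE => /addIn e.
exact/fcard_eq.
Qed.

(** * Orthonormal sets *)

Lemma conjC_form (C : numClosedFieldType) (U : lmodType C)
  (form : {dot U for Num.conj}) x y : form x y = Num.conj (form y x).
Proof. by rewrite hermC expr0 mul1r. Qed.

Lemma natr_bound (R : realType) (x : R[i]) : 0 <= x -> exists n : nat, x < n%:R.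
Proof.
case: x => a b /=; rewrite lecE /= => /andP[/eqP -> a0].
by exists (Num.bound a); rewrite -(rmorph_nat (real_complex R)) ltcR archi_boundP.
Qed.

Definition linear_subspace (K : pzRingType) (U : lmodType K) (V : set U) :=
  V 0 /\ forall (a : K) x y, V x -> V y -> V (a *: x + y).

Section OrthonormalSets.
Variables (R : realType) (U : lmodType R[i]) (form : {dot U for Num.conj}).
Implicit Types (E V : set U).

Lemma orthonormal_neq0 E x : orthonormal_set form E -> E x -> (x == 0) = false.
Proof.
move=> Eo Ex; apply/eqP => x0; have := Eo _ _ Ex Ex.
by rewrite eqxx x0 linear0l => /esym/eqP; rewrite oner_eq0.
Qed.

Lemma form_orthonormal_sum E n (s : 'I_n -> U) (c : 'I_n -> R[i]) j :
  orthonormal_set form E -> injective s -> (forall i, E (s i)) ->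
  form (\sum_i c i *: s i) (s j) = c j.
Proof.
move=> Eo sinj sE; rewrite linear_sumlz (bigD1 j)//= linearZl_LR /= (Eo _ _ (sE j) (sE j)).
rewrite eqxx mulr1 big1 ?addr0// => i ij.
by rewrite linearZl_LR /= (Eo _ _ (sE i) (sE j)) (inj_eq sinj) (negPf ij) mulr0.
Qed.

(** The difference of [v] and its projection onto the span of the [s i] has
    nonnegative square norm. *)
Lemma bessel E n (s : 'I_n -> U) v :
  orthonormal_set form E -> injective s -> (forall i, E (s i)) ->
  \sum_i `|form (s i) v| ^+ 2 <= form v v.
Proof.
move=> Eo sinj sE; pose p := \sum_i form v (s i) *: s i.
have pp : form p p = \sum_i `|form (s i) v| ^+ 2.
  rewrite {2}/p raddf_sum /=; apply: eq_bigr => i _.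
  rewrite linearZr_LR /= /p (form_orthonormal_sum _ _ Eo)//.
  by rewrite [form (s i) v]conjC_form norm_conjC normCK mulrC.
have vp : form v p = form p p.
  rewrite pp raddf_sum /=; apply: eq_bigr => i _.
  by rewrite linearZr_LR /= [form (s i) v]conjC_form norm_conjC normCK mulrC.
rewrite -pp -subr_ge0; have := dnorm_ge0 form (v - p).
by rewrite dnormB vp -conjC_form opprD addrA addrK.
Qed.

(** By Bessel's inequality only finitely many coefficients of [v] have square
    modulus at least [1 / (k + 1)], for each [k]. *)
Lemma countable_nonorthogonal E v :
  orthonormal_set form E -> countable [set e | E e /\ form e v != 0].
Proof.
move=> Eo; pose F (k : nat) := [set e | E e /\ k.+1%:R^-1 <= `|form e v| ^+ 2].
suff -> : [set e | E e /\ form e v != 0] = \bigcup_k F k.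
  apply: bigcup_countable => // k _; apply: finite_set_countable.
  apply: contrapT => /infiniteP/card_le_injection[|s sF sinj]; first by exists 0%N.
  have [n nP] : exists n : nat, k.+1%:R * form v v < n%:R.
    by apply: natr_bound; rewrite mulr_ge0.
  suff : n%:R <= k.+1%:R * form v v by rewrite lt_geF.
  rewrite mulrC -ler_pdivrMr ?ltr0n//.
  apply: le_trans (bessel v Eo (s := fun i : 'I_n => s i) _ _).
  - rewrite -[n in n%:R]card_ord -sumr_const mulr_suml; apply: ler_sum => i _.
    by rewrite mul1r; have [] := sF i I.
  - by move=> i j /(sinj _ _ I I)/val_inj.
  - by move=> i; have [] := sF i I.
apply/seteqP; split=> [e [Ee ev]|e [k _ [Ee ek]]].
  have [k kP] : exists k : nat, (`|form e v| ^+ 2)^-1 < k%:R.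
    by apply: natr_bound; rewrite invr_ge0 exprn_ge0.
  exists k => //; split=> //.
  rewrite -[leRHS]invrK lef_pV2 ?posrE ?invr_gt0 ?exprn_gt0 ?normr_gt0 ?ltr0n//.
  by apply: le_trans (ltW kP) _; rewrite ler_nat.
split=> //; apply/eqP => ev; move: ek.
by rewrite ev normr0 expr0n lt_geF// invr_gt0 ltr0n.
Qed.

(** The comparison principle for Hilbert dimensions.  If [I] is finite and [E]
    had more elements, a nontrivial combination of elements of [E] would be
    orthogonal to all the [v i].  If [I] is infinite, every element of [E] is
    not orthogonal to some [v i], and each [v i] serves only countably many
    elements. *)
Lemma card_orthonormal_le_total (J : choiceType) V E (I : set J) (v : J -> U) :
  linear_subspace V -> E `<=` V -> orthonormal_set form E ->
  (forall x, V x -> (forall i, I i -> form x (v i) = 0) -> x = 0) ->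
  E #<= I.
Proof.
move=> Vlin EV Eo Vv; have [Ifin|Ioo] := pselect (finite_set I); last first.
  apply: (@card_le_countable_fibers _ _ _ _ (fun e i => form e (v i) != 0)) => //.
    move=> e Ee; apply: contrapT => ne.
    suff /eqP : e = 0 by rewrite (orthonormal_neq0 Eo Ee).
    apply: Vv => [|i Ii]; first exact: EV.
    by apply/eqP/negPn/negP => ei; apply: ne; exists i.
  by move=> i _; exact: countable_nonorthogonal.
apply: contrapT => nEI; set n := #|` fset_set I|%N.
have [B BE Bn] : exists2 B : {fset U}, [set` B] `<=` E & (n < #|` B|%N)%N.
  have [Efin|Eoo] := pselect (finite_set E); last exact: infinite_set_fset.
  exists (fset_set E); first by rewrite fset_setK.
  rewrite ltnNge; apply/negP => mn; apply: nEI.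
  have [m Em] := (finite_setP _).1 Efin; have [p Ip] := (finite_setP _).1 Ifin.
  rewrite (card_le_eql Em) (card_le_eqr Ip) card_le_II.
  by rewrite -(card_fset_set Em) -(card_fset_set Ip).

pose s (i : 'I_n.+1) := nth 0 (enum_fset B) i.
have sE i : E (s i).
  by apply: BE; rewrite /= mem_nth// (leq_trans _ Bn).
have sinj : injective s.
  move=> i j /eqP; rewrite nth_uniq ?fset_uniq ?(leq_trans _ Bn)//.
  by move=> /eqP /val_inj.
pose M := \matrix_(i < n.+1, j < n) form (s i) (v (tnth (in_tuple (enum_fset (fset_set I))) j)).
(* The matrix has more rows than columns, so some combination of the [s i] is
   orthogonal to every [v i]. *)
have : kermx M != 0.
  by rewrite -mxrank_eq0 mxrank_ker subn_eq0 -ltnNge ltnS rank_leq_col.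
move=> /rowV0Pn[c /sub_kermxP cM].
suff c0 : c = 0 by rewrite c0 eqxx.
pose x := \sum_i c 0 i *: s i.
suff x0 : x = 0.
  apply/rowP => j; rewrite mxE -(form_orthonormal_sum (c 0) j Eo sinj sE).
  by rewrite -/x x0 linear0l.
apply: Vv.
  rewrite /x; elim/big_ind : _ => [|y z Vy Vz|i _]; first exact: Vlin.1.
    by rewrite -[y]scale1r; exact: Vlin.2.
  by rewrite -[_ *: _]addr0; apply: Vlin.2; [exact: EV|exact: Vlin.1].
move=> i Ii.
have /tnthP[j ->] : i \in in_tuple (enum_fset (fset_set I)) by rewrite in_fset_set ?inE.
have := congr1 (fun N : 'rV_n => N 0 j) cM; rewrite !mxE => <-.
by rewrite linear_sumlz; apply: eq_bigr => k _; rewrite linearZl_LR !mxE.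
Qed.

(** Otherwise the basis could be enlarged by the normalized [x]. *)
Lemma orthonormal_basis_complete V E x : linear_subspace V ->
  orthonormal_basis form V E -> V x -> (forall e, E e -> form x e = 0) -> x = 0.
Proof.
move=> Vlin [EV Eo Emax] Vx xE; apply/eqP/negPn/negP => x0.
have x1 : 0 < form x x by rewrite dnorm_gt0.
pose r := (sqrtC (form x x))^-1; pose y := r *: x.
have r0 : 0 < r by rewrite invr_gt0 sqrtC_gt0.
have yy : form y y = 1.
  rewrite dnormZ ger0_norm ?(ltW r0)// exprVn sqrtCK mulVf// gt_eqF//.
have yE e : E e -> form y e = 0 by move=> Ee; rewrite linearZl_LR /= xE// mulr0.
suff Ey : E y by have := yE _ Ey; rewrite yy => /eqP; rewrite oner_eq0.
suff <- : E `|` [set y] = E by right.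
apply: Emax; first exact: subsetUl.
- move=> z [/EV//|->]; rewrite /y -[_ *: _]addr0; apply: Vlin.2 => //.
  exact: Vlin.1.
- have yNE e : E e -> y != e.
    by move=> Ee; apply/eqP => ye; move: (yE _ Ee); rewrite -ye yy => /eqP; rewrite oner_eq0.
  move=> e f [Ee|->] [Ef|->].
  + exact: Eo.
  + by rewrite conjC_form yE// conjC0 eq_sym (negPf (yNE _ Ee)).
  + by rewrite yE// (negPf (yNE _ Ef)).
  + by rewrite yy eqxx.
Qed.

End OrthonormalSets.

Section SumForm.
Variables (C : numClosedFieldType) (U V : lmodType C).
Variables (f : {dot U for Num.conj}) (g : {dot V for Num.conj}).

Definition sum_form (p q : U * V) : C := f p.1 q.1 + g p.2 q.2.

Let sum_form_bilinear : bilinear_for *%R (Num.conj \; *%R) sum_form.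
Proof.
split=> z a x y; rewrite /sum_form /=.
  by rewrite !linearPl /= mulrDr addrACA.
by rewrite !linearPr /= mulrDr addrACA.
Qed.
HB.instance Definition _ :=
  bilinear_isBilinear.Build C (U * V)%type (U * V)%type C *%R (Num.conj \; *%R)
  sum_form sum_form_bilinear.

Let sum_form_hermitian p q : sum_form p q = (-1) ^+ false * Num.conj (sum_form q p).
Proof.
by rewrite expr0 mul1r /sum_form (conjC_form f) (conjC_form g) -rmorphD.
Qed.
HB.instance Definition _ := isHermitianSesquilinear.Build C (U * V)%type false Num.conj
  sum_form sum_form_hermitian.

Let sum_form_gt0 p : p != 0 -> 0 < sum_form p p.
Proof.
case: p => x y xy; rewrite /sum_form /= lt_def addr_ge0// andbT.
rewrite paddr_eq0// !dnorm_eq0; apply: contraNN xy => /andP[/eqP -> /eqP ->].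
exact: eqxx.
Qed.
HB.instance Definition _ := isDotProduct.Build C (U * V)%type sum_form sum_form_gt0.

End SumForm.

Definition sum_to_prod (U V : nmodType) (z : U + V) : U * V :=
  match z with inl x => (x, 0) | inr y => (0, y) end.

Section OrthonormalSum.
Variables (R : realType) (U V : lmodType R[i]).
Variables (f : {dot U for Num.conj}) (g : {dot V for Num.conj}).
Variables (E : set U) (F : set V).
Hypotheses (Eo : orthonormal_set f E) (Fo : orthonormal_set g F).

Lemma sum_to_prod_inj : {in set_sum E F &, injective (@sum_to_prod U V)}.
Proof.
move=> [x|y] [x'|y'] /set_mem /= z /set_mem /= z' [].
- by move=> ->.
- by move=> /eqP; rewrite (orthonormal_neq0 Eo z).
- by move=> /esym/eqP; rewrite (orthonormal_neq0 Eo z').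
- by move=> ->.
Qed.

Lemma orthonormal_set_sum : orthonormal_set (sum_form f g) (@sum_to_prod U V @` set_sum E F).
Proof.
move=> _ _ [[x|y] /= z <-] [[x'|y'] /= z' <-]; rewrite /sum_form xpair_eqE /=.
- by rewrite linear0l addr0 eqxx andbT (Eo z z').
- by rewrite linear0l linear0r addr0 (orthonormal_neq0 Eo z).
- by rewrite linear0l linear0r addr0 [0 == x']eq_sym (orthonormal_neq0 Eo z').
- by rewrite linear0l add0r eqxx (Fo z z').
Qed.

End OrthonormalSum.

(** * Projections and selfadjoint relations *)

Section CauchySchwarz.
Variables (C : numClosedFieldType) (U : lmodType C) (form : {dot U for Num.conj}).

(** The square of the distance from [u] to the line through [v]; it yields the
    Cauchy-Schwarz inequality, and the orthogonality of a nearest vector. *)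
Lemma dnorm_sub_projection u v : v != 0 ->
  let w := u - (form u v / form v v) *: v in
  form w w = form u u - `|form u v| ^+ 2 / form v v.
Proof.
move=> v0 w; have vv : 0 < form v v by rewrite dnorm_gt0.
have vr : Num.conj (form v v) = form v v by rewrite -conjC_form.
have e : form u ((form u v / form v v) *: v) = `|form u v| ^+ 2 / form v v.
  by rewrite linearZr_LR /= rmorphM fmorphV /= vr normCK mulrC mulrA.
rewrite /w dnormB dnormZ e normrM normfV (ger0_norm (ltW vv)) exprMn exprVn.
have -> : Num.conj (`|form u v| ^+ 2 / form v v) = `|form u v| ^+ 2 / form v v.
  by rewrite rmorphM fmorphV /= vr rmorphXn /= conj_normC.
by rewrite -mulrA [_ ^- 2 * _]mulrC expr2 invfM mulVKf ?gt_eqF// opprD addrA addrK.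
Qed.

Lemma cauchy_schwarz u v : `|form u v| ^+ 2 <= form u u * form v v.
Proof.
have [->|v0] := eqVneq v 0; first by rewrite !linear0r normr0 expr0n.
have := dnorm_ge0 form (u - (form u v / form v v) *: v).
rewrite dnorm_sub_projection// subr_ge0 ler_pdivrMr// dnorm_gt0//.
Qed.

Lemma parallelogram u v :
  form (u - v) (u - v) + form (u + v) (u + v) = (form u u + form v v) *+ 2.
Proof. by rewrite dnormB dnormD addrACA addNr addr0 mulr2n. Qed.
End CauchySchwarz.

Lemma sqr_normD_le (C : numClosedFieldType) (x y : C) :
  `|x + y| ^+ 2 <= (`|x| ^+ 2 + `|y| ^+ 2) *+ 2.
Proof.
have -> : (`|x| ^+ 2 + `|y| ^+ 2) *+ 2 = `|x + y| ^+ 2 + `|x - y| ^+ 2 :> C.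
  rewrite !normCK !rmorphD !rmorphN /=; ring.
by rewrite lerDl exprn_ge0.
Qed.

Section Completeness.
Variables (R : realType).

(** Convergence is expressed through the forms themselves: the norm of a product
    of two Hilbert spaces is the maximum norm, which is not the one of
    [sum_form]. *)
Definition form_cauchy (U : lmodType R[i]) (form : U -> U -> R[i]) (s : nat -> U) :=
  forall e : R[i], 0 < e -> exists N, forall m n, (N <= m)%N -> (N <= n)%N ->
    form (s m - s n) (s m - s n) < e.

Definition form_limit (U : lmodType R[i]) (form : U -> U -> R[i]) (s : nat -> U) l :=
  forall e : R[i], 0 < e -> exists N, forall n, (N <= n)%N ->
    form (s n - l) (s n - l) < e.

Definition form_complete (U : lmodType R[i]) (form : U -> U -> R[i]) :=
  forall s, form_cauchy form s -> exists l, form_limit form s l.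

Lemma exists_invn_lt (e : R[i]) : 0 < e -> exists N, forall n : nat, (N <= n)%N -> n.+1%:R^-1 < e.
Proof.
move=> e0; have [|N NP] := @natr_bound _ e^-1; first by rewrite invr_ge0 ltW.
exists N => n Nn; rewrite -[e]invrK ltf_pV2 ?posrE ?invr_gt0 ?ltr0n//.
by apply: lt_le_trans NP _; rewrite ler_nat leqW.
Qed.

Lemma eq0_small (x c : R[i]) : (forall e : R[i], 0 < e -> `|x| ^+ 2 <= c * e) -> x = 0.
Proof.
move=> xP; apply/eqP/negPn/negP => x0.
have x2 : 0 < `|x| ^+ 2 by rewrite exprn_gt0 ?normr_gt0.
have := xP 1 ltr01; rewrite mulr1 => xc; have c0 := lt_le_trans x2 xc.
have := xP (`|x| ^+ 2 / (c *+ 2)) _; rewrite divr_gt0 ?mulrn_wgt0// => /(_ isT).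
have -> : c * (`|x| ^+ 2 / (c *+ 2)) = `|x| ^+ 2 / 2%:R.
  by field; rewrite gt_eqF.
by rewrite lt_geF// ltr_pdivrMr// mulr_natr mulr2n ltrDl.
Qed.

Section OneForm.
Variables (U : lmodType R[i]) (form : {dot U for Num.conj}).

(** Identities between values of the form pass to the limit; this is how closedness
    of adjoint relations is used. *)
Lemma form_limit_eq (s t : nat -> U) l m y z :
  form_limit form s l -> form_limit form t m ->
  (forall n, form (s n) y = form (t n) z) -> form l y = form m z.
Proof.
move=> sl tm st; apply/eqP; rewrite -subr_eq0; apply/eqP.
apply: (@eq0_small _ ((form y y + form z z) *+ 2)) => e e0.
have [N NP] := sl _ e0; have [M MP] := tm _ e0.
pose n := maxn N M; have {NP}NP := NP n (leq_maxl _ _); have {MP}MP := MP n (leq_maxr _ _).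
have -> : form l y - form m z = form (t n - m) z - form (s n - l) y.
  by rewrite !linearBl /= st; ring.
have pw : `|form (t n - m) z - form (s n - l) y| ^+ 2 <=
    (`|form (t n - m) z| ^+ 2 + `|form (s n - l) y| ^+ 2) *+ 2.
  by rewrite (le_trans (sqr_normD_le _ _))// normrN.
apply: le_trans pw _.
rewrite mulrnAl mulrDl ler_wMn2r// addrC lerD//.
- by apply: le_trans (cauchy_schwarz _ _ _) _; rewrite mulrC ler_wpM2l// ltW.
- by apply: le_trans (cauchy_schwarz _ _ _) _; rewrite mulrC ler_wpM2l// ltW.
Qed.

Lemma exists_almost_nearest (L : set U) z : L !=set0 -> exists d : R[i],
  (forall x, L x -> d <= form (z - x) (z - x)) /\
  (forall e, 0 < e -> exists2 x, L x & form (z - x) (z - x) < d + e).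
Proof.
move=> [x0 Lx0]; pose q x := complex.Re (form (z - x) (z - x)).
have qE x : form (z - x) (z - x) = (q x)%:C by rewrite RRe_real// ger0_real.
pose D := q @` L.
have D0 : lbound D 0.
  by move=> _ [x _ <-]; rewrite -ler0c -qE.
have Dlb : has_lbound D by exists 0.
have Dinf : has_inf D by split=> //; exists (q x0); exists x0.
exists (inf D)%:C; split=> [x Lx|e e0].
  by rewrite qE lecR; apply: ge_inf => //; exists x.
have eE : e = (complex.Re e)%:C by rewrite RRe_real// gtr0_real.
have e0' : 0 < complex.Re e by rewrite -ltcR -eE.
have [_ [x Lx <-] xe] := inf_adherent e0' Dinf.
by exists x => //; rewrite qE eE -rmorphD ltcR.
Qed.

(** The projection theorem.  A minimizing sequence is Cauchy by the parallelogram
    law; that it is almost orthogonal to [L] is read off from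
    [dnorm_sub_projection], so that orthogonality passes to the limit. *)
Lemma exists_projection (L : set U) z : linear_subspace L ->
  (forall s, (forall n, L (s n)) -> form_cauchy form s -> exists2 l, L l & form_limit form s l) ->
  exists2 l, L l & forall x, L x -> form (z - l) x = 0.
Proof.
move=> Llin Lc; have [|d [dL dinf]] := @exists_almost_nearest L z; first by exists 0; exact: Llin.1.
have LD x y : L x -> L y -> L (x + y) by rewrite -[x in x + y]scale1r; exact: Llin.2.
have LZ a x : L x -> L (a *: x).
  by move=> Lx; rewrite -[_ *: _]addr0; apply: Llin.2 => //; exact: Llin.1.
have /choice[s sP] n : exists x, L x /\ form (z - x) (z - x) < d + n.+1%:R^-1.
  by have [|x] := dinf n.+1%:R^-1; [rewrite invr_gt0 ltr0n|exists x].
have sorth n x : L x -> `|form (z - s n) x| ^+ 2 <= form x x * n.+1%:R^-1.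
  move=> Lx; have [->|x0] := eqVneq x 0; first by rewrite !linear0r normr0 expr0n mul0r.
  set t := form (z - s n) x / form x x.
  have := dL (s n + t *: x) (LD _ _ (sP n).1 (LZ _ _ Lx)).
  rewrite opprD addrA dnorm_sub_projection// => dx.
  rewrite mulrC -ler_pdivrMr ?dnorm_gt0//.
  have := le_lt_trans dx (_ : _ < d + n.+1%:R^-1 - `|form (z - s n) x| ^+ 2 / form x x).
  rewrite ltrD2r (sP n).2 => /(_ isT).
  by rewrite -addrA ltrDl subr_gt0 => /ltW.
have [||l Ll sl] := Lc s.
- by move=> n; have [] := sP n.
- move=> e e0.
  have [|N NP] := @exists_invn_lt (e / 4%:R); first by rewrite divr_gt0.
  exists N => m n Nm Nn.
  (* The midpoint of two elements of L is no closer to z than d. *)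
  have mid : form ((z - s n) + (z - s m)) ((z - s n) + (z - s m)) =
      4%:R * form (z - 2%:R^-1 *: (s n + s m)) (z - 2%:R^-1 *: (s n + s m)).
    have -> : (z - s n) + (z - s m) = 2%:R *: (z - 2%:R^-1 *: (s n + s m)).
      rewrite scalerBr scalerA divff ?pnatr_eq0// scale1r scaler_nat mulr2n opprD.
      by rewrite addrACA.
    by rewrite dnormZ normr_nat -natrX.
  have dmid : d <= form (z - 2%:R^-1 *: (s n + s m)) (z - 2%:R^-1 *: (s n + s m)).
    by apply: dL; apply: LZ; apply: LD; [exact: (sP n).1|exact: (sP m).1].
  have := parallelogram form (z - s n) (z - s m); rewrite mid.
  have -> : (z - s n) - (z - s m) = s m - s n by rewrite opprB addrC addrA subrK.
  move=> /(canRL (addrK _)) => ->.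
  have sd k : (N <= k)%N -> form (z - s k) (z - s k) < d + e / 4%:R.
    by move=> Nk; apply: lt_trans (sP k).2 _; rewrite ltrD2l NP.
  have -> : e = ((d + e / 4%:R) + (d + e / 4%:R)) *+ 2 - 4%:R * d by field.
  by rewrite ltr_leB// ?ltrMn2r ?ltrD ?sd// ler_wpM2l.
exists l => // x Lx; apply: (@eq0_small _ (form x x *+ 4)) => e e0.
have [N NP] := exists_invn_lt e0; have [M MP] := sl _ e0.
pose n := maxn N M; have {NP}NP := NP n (leq_maxl _ _); have {MP}MP := MP n (leq_maxr _ _).
have -> : z - l = (z - s n) + (s n - l) by rewrite addrA subrK.
rewrite linearDl; apply: le_trans (sqr_normD_le _ _) _.
have -> : form x x *+ 4 * e = (form x x * e + form x x * e) *+ 2.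
  by rewrite -mulr2n -mulrnA mulrnAl.
rewrite ler_wMn2r// lerD//.
- by apply: le_trans (sorth _ _ Lx) _; rewrite ler_wpM2l// ltW.
- by apply: le_trans (cauchy_schwarz _ _ _) _; rewrite mulrC ler_wpM2l// ltW.
Qed.

Lemma form_limit_linear a (s t : nat -> U) l m :
  form_limit form s l -> form_limit form t m ->
  form_limit form (fun n => a *: s n + t n) (a *: l + m).
Proof.
move=> sl tm e e0; pose d := e / ((`|a| ^+ 2 + 1) *+ 2).
have a0 : 0 < `|a| ^+ 2 + 1 by rewrite ltr_wpDl// exprn_ge0.
have d0 : 0 < d by rewrite divr_gt0// mulrn_wgt0.
have [N NP] := sl _ d0; have [M MP] := tm _ d0; exists (maxn N M) => n.
rewrite geq_max => /andP[/NP ns /MP nt].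
have -> : a *: s n + t n - (a *: l + m) = a *: (s n - l) + (t n - m).
  by rewrite scalerBr opprD addrACA.
have -> : e = (`|a| ^+ 2 * d + d) *+ 2.
  by rewrite /d; field; rewrite gt_eqF.
apply: (@le_lt_trans _ _
  ((form (a *: (s n - l)) (a *: (s n - l)) + form (t n - m) (t n - m)) *+ 2)).
  by rewrite -parallelogram lerDr.
rewrite ltrMn2r/= dnormZ; apply: ler_ltD => //.
by apply: ler_wpM2l; [exact: exprn_ge0|exact: ltW].
Qed.

(** A selfadjoint relation minus a nonreal number is onto.  Its range is closed,
    because [|lam - conj lam|^2 |p|^2 <= 4 |p' - lam p|^2] for [(p, p')] in [T],
    and a vector [w] orthogonal to it satisfies [(w, conj lam w)] in [T], which
    forces [w = 0] since [(w', w)] is real for [(w, w')] in [T]. *)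
Lemma surjective_shift (T : set (U * U)) (lam : R[i]) z :
  form_complete form -> linear_relation T ->
  (forall p, T p <-> forall q, T q -> form p.2 q.1 = form p.1 q.2) ->
  Num.conj lam != lam -> exists2 p, T p & p.2 - lam *: p.1 = z.
Proof.
move=> Uc Tlin Tsa lamN.
have TB p q : T p -> T q -> T (p - q).
  by move=> Tp Tq; rewrite addrC -scaleN1r; exact: Tlin.2.
pose c := `|lam - Num.conj lam| ^+ 2.
have c0 : 0 < c by rewrite exprn_gt0// normr_gt0 subr_eq0 eq_sym.
have bound p : T p ->
    c * form p.1 p.1 <= 4%:R * form (p.2 - lam *: p.1) (p.2 - lam *: p.1).
  move=> Tp; have [->|p0] := eqVneq p.1 0; first by rewrite linear0r mulr0 mulr_ge0.
  set w := p.2 - _.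
  have pp : 0 < form p.1 p.1 by rewrite dnorm_gt0.
  have ew : form w p.1 - form p.1 w = - (lam - Num.conj lam) * form p.1 p.1.
    rewrite linearBl linearBr linearZl_LR linearZr_LR /= ((Tsa _).1 Tp _ Tp); ring.
  rewrite -(ler_pM2r pp).
  have -> : c * form p.1 p.1 * form p.1 p.1 = `|form w p.1 - form p.1 w| ^+ 2.
    by rewrite ew normrM normrN exprMn (ger0_norm (ltW pp)) -mulrA -expr2.
  apply: le_trans (sqr_normD_le _ _) _.
  rewrite normrN [form p.1 w]conjC_form norm_conjC -mulr2n -mulrnA -[leLHS]mulr_natl -[leRHS]mulrA.
  by rewrite ler_wpM2l// cauchy_schwarz.
have limT s p : (forall n, T (s n)) -> form_limit form (fst \o s) p.1 ->
    form_limit form (snd \o s) p.2 -> T p.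
  move=> Ts s1 s2; apply/Tsa => q Tq; apply: form_limit_eq s2 s1 _ => n.
  exact: (Tsa _).1 (Ts n) _ Tq.
pose L := [set p.2 - lam *: p.1 | p in T].
have [||l [p Tp <-] lorth] := @exists_projection L z.
- split=> [|a _ _ [p Tp <-] [q Tq <-]].
    by exists (0, 0); [exact: Tlin.1|rewrite /= scaler0 subr0].
  exists (a *: p + q); first exact: Tlin.2.
  by rewrite /= scalerBr scalerDr opprD addrACA !scalerA mulrC.
- move=> t tL tc.
  have /choice[s sP] n : exists p, T p /\ p.2 - lam *: p.1 = t n.
    by have [p] := tL n; exists p.
  have s1c : form_cauchy form (fst \o s).
    move=> e e0; have [|N NP] := tc (c * e / 4%:R); first by rewrite divr_gt0 ?(mulr_gt0 c0 e0).
    exists N => m n Nm Nn; have := NP _ _ Nm Nn.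
    rewrite -!(sP _).2 => /= lte; rewrite -(ltr_pM2l c0).
    have := bound _ (TB _ _ (sP m).1 (sP n).1) => /= le1.
    apply: le_lt_trans le1 _.
    rewrite mulrC -ltr_pdivlMr//; apply: le_lt_trans lte; rewrite le_eqVlt.
    apply/orP; left; apply/eqP; congr (form _ _);
      by rewrite scalerBr !opprB addrACA [RHS]addrACA [- _ + _]addrC.
  have [p1 s1p] := Uc _ s1c; have [l tl] := Uc _ tc.
  exists l => //; exists (p1, lam *: p1 + l); last by rewrite /= addrC addKr.
  apply: (limT s); [by move=> n; have [] := sP n|exact: s1p|].
  have -> : snd \o s = (fun n => lam *: (fst \o s) n + t n).
    by apply/funext => n /=; rewrite -(sP n).2 addrC subrK.
  exact: form_limit_linear.
have w0 : z - (p.2 - lam *: p.1) = 0; last first.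
  by exists p => //; apply/esym/eqP; rewrite -subr_eq0 w0.
set w := z - _ in lorth *.
have Tw : T (w, Num.conj lam *: w).
  apply/Tsa => q Tq; have /eqP := lorth _ (imageP _ Tq).
  rewrite linearBr linearZr_LR /= subr_eq0 => /eqP ->.
  by rewrite linearZl_LR.
have /eqP := (Tsa _).1 Tw _ Tw.
rewrite /= linearZl_LR linearZr_LR /= conjCK -subr_eq0 -mulrBl mulf_eq0 subr_eq0 (negPf lamN).
by rewrite dnorm_eq0 => /eqP.
Qed.

End OneForm.
End Completeness.

(** * Completeness *)

Lemma sum_form_complete (R : realType) (U V : lmodType R[i])
    (f : {dot U for Num.conj}) (g : {dot V for Num.conj}) :
  form_complete f -> form_complete g -> form_complete (sum_form f g).
Proof.
move=> fc gc s sc.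
have sc1 : form_cauchy f (fst \o s).
  move=> e /sc[N NP]; exists N => m n Nm Nn; apply: le_lt_trans (NP _ _ Nm Nn).
  by rewrite /sum_form lerDl dnorm_ge0.
have sc2 : form_cauchy g (snd \o s).
  move=> e /sc[N NP]; exists N => m n Nm Nn; apply: le_lt_trans (NP _ _ Nm Nn).
  by rewrite /sum_form lerDr dnorm_ge0.
have [[l sl] [m sm]] := (fc _ sc1, gc _ sc2).
exists (l, m) => e e0; have e2 : 0 < e / 2%:R by rewrite divr_gt0.
have [[N NP] [M MP]] := (sl _ e2, sm _ e2); exists (maxn N M) => n.
rewrite geq_max => /andP[/NP nl /MP nm].
by rewrite [e]splitr /sum_form ltrD.
Qed.

Section HilbertSpace.
Variables (R : realType) (H : hilbertType R).

Lemma inner_complete : form_complete (@inner R H).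
Proof.
move=> s sc.
have /cauchy_cvg/cvg_ex[l sl] : cauchy (s @ \oo).
  apply/cauchy_ballP => e e0.
  have [N NP] := sc _ (exprn_gt0 2 e0).
  exists ([set s n | n in [set n | (N <= n)%N]], [set s n | n in [set n | (N <= n)%N]]).
    by split; exists N => // n Nn; exists n.
  move=> [_ _] [[m Nm <-] [n Nn <-]] /=; rewrite -ball_normE /=.
  by rewrite -(ltr_pXn2r (n := 2)) ?nnegrE ?(ltW e0)// -inner_normE NP.
exists l => e e0.
have r0 : 0 < sqrtC e by rewrite sqrtC_gt0.
have /cvgrPdist_lt/(_ _ r0)[N _ NP] := sl.
exists N => n Nn; rewrite inner_normE distrC -[e]sqrtCK.
by rewrite ltr_pXn2r ?nnegrE ?(ltW r0)//; exact: NP.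
Qed.

(** Passes from density in the product topology, as in the definition of a boundary
    relation, to limits in the sense of the forms. *)
Lemma closure_form_limit (D : set (H * H)) q : closure D q ->
  exists s : nat -> H * H, [/\ forall n, D (s n),
    form_limit inner (fst \o s) q.1 & form_limit inner (snd \o s) q.2].
Proof.
move=> Dq; have /choice[s sP] n : exists p, D p /\ ball q n.+1%:R^-1 p.
  have [|p [Dp qp]] := Dq (ball q (n.+1%:R^-1 : R[i])); last by exists p.
  by apply: nbhsx_ballx; rewrite invr_gt0 ltr0n.
have small (x y : H) n : ball x (n.+1%:R^-1 : R[i]) y -> inner (y - x) (y - x) <= n.+1%:R^-1.
  rewrite -ball_normE /= => xy; rewrite inner_normE distrC expr2.
  apply: le_trans (ler_piMr _ (_ : _ <= 1)) (ltW xy) => //.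
  by apply: le_trans (ltW xy) _; rewrite invf_le1 ?ltr0n// ler1n.
exists s; split=> [n|e e0|e e0]; first by have [] := sP n.
- have [N NP] := exists_invn_lt e0; exists N => n Nn.
  apply: le_lt_trans (NP _ Nn); apply: small.
  by have [_ []] := sP n.
- have [N NP] := exists_invn_lt e0; exists N => n Nn.
  apply: le_lt_trans (NP _ Nn); apply: small.
  by have [_ []] := sP n.
Qed.
End HilbertSpace.

(** * Boundary relations *)

Section BoundaryRelation.
Variables (R : realType) (H K : hilbertType R).
Variables (A : set (H * H)) (G : set ((H * H) * (K * K))).
Hypotheses (hG : boundary_relation A G).
Implicit Types (lam : R[i]) (w x : H * K).

Let Glin : linear_relation G. Proof. by case: hG. Qed.
Let Gdom : rdom G `<=` radjoint A. Proof. by case: hG => ? []. Qed.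
Let Gdense : radjoint A `<=` closure (rdom G). Proof. by case: hG => ? []. Qed.
Let Green p q : G p -> G q -> green_identity p q. Proof. by case: hG => ? ? + _; apply. Qed.
Let Gmax q : (forall p, G p -> green_identity p q) -> G q. Proof. by case: hG => ? ? _; apply. Qed.

(** [resolvent lam w x] says that [x = (T - lam)^-1 w] for the selfadjoint relation
    T formed by the pairs [((f, h), (f', - h'))] with [((f, f'), (h, h'))] in
    [G]. *)
Definition resolvent lam w x :=
  G ((x.1, w.1 + lam *: x.1), (x.2, - (w.2 + lam *: x.2))).

Lemma exists_resolvent lam : Num.conj lam != lam ->
  exists S, forall w, resolvent lam w (S w).
Proof.
move=> lamN; pose form := sum_form (@inner R H) (@inner R K).
pose T := [set p : (H * K) * (H * K) | G ((p.1.1, p.2.1), (p.1.2, - p.2.2))].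
suff /choice[S SP] : forall w, exists x, resolvent lam w x by exists S.
move=> w; have [||||p Tp <-] := @surjective_shift R _ form T lam w.
- by apply: sum_form_complete; exact: inner_complete.
- split=> [|a p q Tp Tq]; first by rewrite /T /= oppr0; exact: Glin.1.
  suff e : - (a *: p + q).2.2 = a *: - p.2.2 - q.2.2.
    set r := a *: p + q in e *.
    rewrite -[T r]/(G ((r.1.1, r.2.1), (r.1.2, - r.2.2))) e.
    exact: Glin.2 a _ _ Tp Tq.
  by rewrite scalerN -opprD.
- move=> p; split=> [Tp q Tq|pq].
    have := Green Tp Tq; rewrite /green_identity /= linearNl linearNr opprK.
    by rewrite /form /sum_form => /(canRL (subrK _)) ->; ring.
  apply: Gmax => q Gq; have /pq : T ((q.1.1, q.2.1), (q.1.2, - q.2.2)).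
    by rewrite /T /= opprK; case: q Gq => [[? ?] [? ?]].
  move=> pqE; have {pqE} : inner p.2.1 q.1.1 + inner p.2.2 q.2.1 =
      inner p.1.1 q.1.2 + inner p.1.2 (- q.2.2) := pqE.
  rewrite linearNr => /(congr1 Num.conj).
  rewrite rmorphD rmorphB /= -!conjC_form => /(canRL (addrK _)) e.
  rewrite /green_identity /= linearNr /= e; ring.
- by [].
by exists p.1; rewrite /resolvent /= !subrK -/(T _).
Qed.

(** Green's identity, solved for the data [w] and [w'] of the two resolvents. *)
Lemma resolvent_adjoint lam w x w' x' :
  resolvent lam w x -> resolvent (Num.conj lam) w' x' ->
  sum_form (@inner R H) (@inner R K) w x' = sum_form (@inner R H) (@inner R K) x w'.
Proof.
move=> wx wx'; have := Green wx wx'; rewrite /green_identity /sum_form /=.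
rewrite !linearDl !linearDr !linearNl !linearNr !linearDl !linearDr.
rewrite !linearZl_LR !linearZr_LR /= conjCK => e.
apply/eqP; rewrite -subr_eq0; move/eqP: e; rewrite -subr_eq0 => /eqP <-.
by apply/eqP; ring.
Qed.

Definition defect_space lam : set H := rker (Defs.rshift (radjoint A) lam).

Lemma defect_spaceE lam y : defect_space lam y <-> radjoint A (y, lam *: y).
Proof.
split=> [[[p1 p2] Ap [<- /eqP]]|Ay]; last by exists (y, lam *: y); rewrite //= subrr.
by rewrite subr_eq0 => /eqP <-.
Qed.

Lemma linear_defect_space lam : linear_subspace (defect_space lam).
Proof.
split=> [|a x y]; first by apply/defect_spaceE => q _; rewrite scaler0 !linear0l.
move=> /defect_spaceE Ax /defect_spaceE Ay; apply/defect_spaceE => q Aq /=.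
have /= := Ax _ Aq; have /= := Ay _ Aq.
rewrite scalerDr !linearDl !linearZl_LR /= => <- <-; ring.
Qed.

Lemma linear_rmul : linear_subspace (rmul G).
Proof.
split=> [|a x y Gx Gy]; first exact: Glin.1.
rewrite /rmul /=.
suff -> : (0, a *: x + y) = a *: ((0, x) : (H * H) * (K * K)) + (0, y).
  exact: Glin.2.
by congr (_, _); rewrite /= scaler0 addr0.
Qed.

Lemma resolvent_defect lam e x : resolvent lam (0, e) x -> defect_space lam x.1.
Proof.
move=> ex; apply/defect_spaceE; apply: Gdom; exists (x.2, - (e + lam *: x.2)).
by move: ex; rewrite /resolvent /= add0r.
Qed.

(** If the K component of the resolvent vanishes, then [(x.1, y + conj lam x.1)] is
    in [ker G], hence pairs to zero with [dom G], and by density with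
    [(y, lam y)]; this says that the square norm of [y] is zero. *)
Lemma defect_resolvent_eq0 lam y x :
  defect_space lam y -> resolvent (Num.conj lam) (y, 0) x -> x.2 = 0 -> y = 0.
Proof.
move=> /defect_spaceE /Gdense/closure_form_limit[s [sD s1 s2]] yx x0.
move: yx; rewrite /resolvent x0 scaler0 addr0 oppr0 /= => Gx.
have e : inner y (y + Num.conj lam *: x.1) = inner (lam *: y) x.1.
  apply: form_limit_eq s1 s2 _ => n /=.
  have [k Gk] := sD n; have := Green Gk Gx.
  rewrite /green_identity /= !linear0r subrr => /eqP.
  by rewrite subr_eq0 => /eqP.
move: e; rewrite linearDr linearZr_LR linearZl_LR /= conjCK => /(canRL (addrK _)).
by rewrite subrr => /eqP; rewrite dnorm_eq0 => /eqP.
Qed.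

Lemma linear_setT (U : lmodType R[i]) : linear_subspace [set: U].
Proof. by []. Qed.

Section NonrealPoint.
Variable lam : R[i].
Hypothesis lamN : Num.conj lam != lam.

Local Notation D := (defect_number A lam).
Local Notation M := (hdim (@inner2 R K) (rmul G)).
Local Notation E := (hdim (@inner R K) [set: K]).

Let DP : orthonormal_basis (@inner R H) (defect_space lam) D. Proof. exact: hdimP. Qed.
Let MP : orthonormal_basis (sum_form (@inner R K) (@inner R K)) (rmul G) M.
Proof. exact: hdimP. Qed.
Let EP : orthonormal_basis (@inner R K) [set: K] E. Proof. exact: hdimP. Qed.

Let conjlamN : Num.conj (Num.conj lam) != Num.conj lam.
Proof. by rewrite conjCK eq_sym. Qed.

(** The space is the product of the defect space and [mul G], and the family is the
    adjoint, applied to a basis of K, of the map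
    [(y, (h, h')) |-> P_K (S(conj lam) (y, 0)) - (lam h + h')]. A vector orthogonal
    to the family is in the kernel of this map.  Its two terms have orthogonal
    ranges and are both injective, so the vector is zero. *)
Lemma card_defect_sum_le : set_sum D M #<= E.
Proof.
have [S SP] := exists_resolvent lamN.
have [S' S'P] := exists_resolvent conjlamN.
have [DV Do _] := DP; have [MV Mo _] := MP.
rewrite -(card_le_eql (inj_card_eq (sum_to_prod_inj (F := M) Do))).
pose form := sum_form (@inner R H) (sum_form (@inner R K) (@inner R K)).
apply: (@card_orthonormal_le_total R _ form _ (defect_space lam `*` rmul G) _ _
  (fun e => ((S (0, e)).1, (- (Num.conj lam *: e), - e)))).
- split=> [|a x y [x1 x2] [y1 y2]].
    by split; [exact: (linear_defect_space lam).1|exact: linear_rmul.1].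
  by split; [exact: (linear_defect_space lam).2|exact: linear_rmul.2].
- move=> _ [[y|m] /= zD <-]; split=> //=; [exact: DV|exact: linear_rmul.1| |exact: MV].
  exact: (linear_defect_space lam).1.
- exact: orthonormal_set_sum.
move=> [y [h h']] [/= Dy Gh] yh.
set k := (S' (y, 0)).2.
have kE : k = lam *: h + h'.
  apply/eqP; rewrite -subr_eq0; apply/eqP.
  apply: (orthonormal_basis_complete (linear_setT K) EP) => // e Ee.
  have : inner y (S (0, e)).1 +
      (inner h (- (Num.conj lam *: e)) + inner h' (- e)) = 0 := yh e Ee.
  have := resolvent_adjoint (SP (0, e)) (S'P (y, 0)).
  rewrite /sum_form /= linear0l linear0r add0r addr0 -/k => ek.
  rewrite !linearNr linearZr_LR /= conjCK [inner y _]conjC_form -ek -conjC_form => <-.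
  rewrite linearBl linearDl linearZl_LR /=; ring.
(* As (0, (h, h')) is in G, h is the K component of the resolvent at
   - (lam h + h') = - k; comparing it with k gives (k, k) = 0. *)
have res0 : resolvent lam (0, - (lam *: h + h')) (0, h).
  by rewrite /resolvent /= scaler0 addr0 opprD opprK addrAC subrr add0r.
have k0 : k = 0.
  have := resolvent_adjoint res0 (S'P (y, 0)).
  rewrite /sum_form /= !linear0l linear0r addr0 add0r -/k -kE linearNl => /eqP.
  by rewrite oppr_eq0 dnorm_eq0 => /eqP.
have -> : y = 0 := defect_resolvent_eq0 Dy (S'P _) k0.
have h'E : h' = - (lam *: h).
  by apply/eqP; rewrite -addr_eq0 addrC -kE k0.
have := Green Gh Gh; rewrite /green_identity /= !linear0l subrr.
rewrite h'E linearNl linearNr linearZl_LR linearZr_LR /= => e.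
have : (Num.conj lam - lam) * inner h h = 0 by rewrite e; ring.
move=> /eqP; rewrite mulf_eq0 subr_eq0 (negPf lamN) dnorm_eq0 => /eqP ->.
by rewrite scaler0 oppr0.
Qed.

(** Solving for [psi] in K, the resolvent [(f, h) = S(lam) (0, psi)] has [f] in the
    defect space, and [(h, - (psi + lam h))] in [mul G] as soon as [f = 0].  The
    family consists of the vectors representing, as functionals of [psi], the
    coordinates of [f] and of this pair in the bases [D] and [M]: if they all
    vanish then [f = 0], then the pair is zero, and then [psi = 0]. *)
Lemma card_le_defect_sum : E #<= set_sum D M.
Proof.
have [S SP] := exists_resolvent lamN.
have [S' S'P] := exists_resolvent conjlamN.
pose v (z : H + K * K) := match z with
  | inl y => (S' (y, 0)).2
  | inr m => (S' (0, m.1 - Num.conj lam *: m.2)).2 - m.2 end.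
apply: (@card_orthonormal_le_total R _ (@inner R K) _ setT _ _ v) => //.
  by have [] := EP.
move=> psi _ psiv.
have adj w : inner (S (0, psi)).1 w.1 + inner (S (0, psi)).2 w.2 = inner psi (S' w).2.
  have := resolvent_adjoint (SP (0, psi)) (S'P w).
  by rewrite /sum_form /= linear0l add0r => ->.
have f0 : (S (0, psi)).1 = 0.
  apply: (orthonormal_basis_complete (linear_defect_space lam) DP).
    exact: resolvent_defect (SP _).
  move=> e De; have := adj (e, 0); rewrite /= linear0r addr0 => ->.
  exact: (psiv (inl e)).
have := SP (0, psi); rewrite /resolvent f0 scaler0 addr0 /= => Gh.
have : ((S (0, psi)).2, - (psi + lam *: (S (0, psi)).2)) = 0.
  apply: (orthonormal_basis_complete linear_rmul MP) => // m Mm.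
  set h := (S (0, psi)).2; change (inner h m.1 + inner (- (psi + lam *: h)) m.2 = 0).
  rewrite linearNl linearDl linearZl_LR /=.
  have := psiv (inr m) Mm; rewrite /v linearBr.
  have := adj (0, m.1 - Num.conj lam *: m.2); rewrite /= linear0r add0r => <-.
  rewrite linearBr linearZr_LR /= conjCK => <-; ring.
move=> [h0]; rewrite h0 scaler0 addr0 => /eqP.
by rewrite oppr_eq0 => /eqP.
Qed.

End NonrealPoint.
End BoundaryRelation.

(** * The dimension formulas *)

Lemma conj_neq (R : realType) (lam : R[i]) : complex.Im lam != 0 -> Num.conj lam != lam.
Proof.
case: lam => a b /= b0; apply/eqP => -[/eqP].
by rewrite eqNr (negPf b0).
Qed.

Theorem corollary3p4 (R : realType) (H K : hilbertType R)
    (A : set (H * H)) (G : set ((H * H) * (K * K)))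
    (hA : closed_symmetric_operator A) (hG : boundary_relation A G) :
  [/\ forall lam : R[i], complex.Im lam != 0 ->
        defect_number A lam #<= hdim (@inner R K) [set: K],
      forall lam : R[i], complex.Im lam != 0 ->
        finite_set (defect_number A lam) ->
        hdim (@inner R K) [set: K] #=
          set_sum (defect_number A lam) (hdim (@inner2 R K) (rmul G))
    & finite_set (hdim (@inner R K) [set: K]) ->
        forall lam mu : R[i], 0 < complex.Im lam -> complex.Im mu < 0 ->
        defect_number A lam #= defect_number A mu].
Proof.
have dim_eq lam : complex.Im lam != 0 ->
    hdim (@inner R K) [set: K] #=
      set_sum (defect_number A lam) (hdim (@inner2 R K) (rmul G)).
  move=> /conj_neq lamN; apply: Cantor_Bernstein.
    exact: card_le_defect_sum.
  exact: card_defect_sum_le.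
have summand_le lam : complex.Im lam != 0 ->
    defect_number A lam #<= hdim (@inner R K) [set: K] /\
    hdim (@inner2 R K) (rmul G) #<= hdim (@inner R K) [set: K].
  move=> /dim_eq e; rewrite !(card_le_eqr e); split.
    apply: (@card_le_functional _ _ _ _ (fun x z => z = inl x)) => [x Dx|x x' y _ _ -> [->]//].
    by exists (inl x).
  apply: (@card_le_functional _ _ _ _ (fun x z => z = inr x)) => [x Dx|x x' y _ _ -> [->]//].
  by exists (inr x).
split=> [lam /summand_le[]//|lam /dim_eq //|Kfin lam mu /gt_eqF/negbT l0 /lt_eqF/negbT m0].
have [Dl M] := summand_le _ l0; have [Dm _] := summand_le _ m0.
apply: (@card_set_sum_cancel _ _ _ _ _ (hdim (@inner2 R K) (rmul G))).
- exact: card_le_finite Dl Kfin.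
- exact: card_le_finite Dm Kfin.
- exact: card_le_finite M Kfin.
- by apply: card_eq_trans (dim_eq _ m0); rewrite card_eq_sym dim_eq.
Qed.
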